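(* Let $G$ be a step-two nilpotent Lie group with Lie algebra $\mathfrak{g}=\mathfrak{v}\dot{+}\mathfrak{z}$, scalar product $\langle\cdot,\cdot\rangle$ and $j$-mapping $j$ as in the context. Let $\mathcal{O}\subset\mathfrak{g}$ be a coadjoint orbit and let $Y_{\mathfrak{v}}+Y_{\mathfrak{z}}\in\mathcal{O}$, where $Y_{\mathfrak{v}}\in\ker(j(Y_{\mathfrak{z}}))$, be an equilibrium of the Lie-Poisson equation $\frac{dY_{\mathfrak{v}}}{dt}=j(Y_{\mathfrak{z}})Y_{\mathfrak{v}}$, $\frac{dY_{\mathfrak{z}}}{dt}=0$, restricted to $\mathcal{O}$. Let the matrices $M_A,M_B,M_C$ be as in the context. Then the equilibrium $Y_{\mathfrak{v}}+Y_{\mathfrak{z}}$ has the Williamson type (A) $(2\ell-p+n,\;p-2\ell-2k,\;k)$, if $j(Y_{\mathfrak{z}})$ is conjugate to $M_A$ and the rank of $M_A$ is equal to $2n$; (B) $(0,0,n/2)$, if $j(Y_{\mathfrak{z}})$ is conjugate to $M_B$ and the rank of $M_B$ is equal to $2n$; (C) $(2\ell+1+n-p,\;p-2\ell-2k-1,\;k)$, if $j(Y_{\mathfrak{z}})$ is conjugate to $M_C$ and the rank of $M_C$ is equal to $2n$.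
   Context: Setting. $G$ is a Lie group whose real finite-dimensional Lie algebra $\mathfrak{g}$ is step-two nilpotent: $[\mathfrak{g},\mathfrak{g}]\subset\mathfrak{z}$, where $\mathfrak{z}$ is the centre. $\langle\cdot,\cdot\rangle$ is a scalar product (non-degenerate symmetric bilinear form, possibly indefinite) on $\mathfrak{g}$ whose restriction $\langle\cdot,\cdot\rangle_{\mathfrak{z}}$ to $\mathfrak{z}$ is non-degenerate; it defines a left-invariant pseudo-Riemannian metric on $G$. $\mathfrak{v}=\mathfrak{z}^{\perp}$, so $\mathfrak{g}=\mathfrak{v}\dot{+}\mathfrak{z}$ (orthogonal direct sum), and the restriction $\langle\cdot,\cdot\rangle_{\mathfrak{v}}$ is non-degenerate. Write $Y=Y_{\mathfrak{v}}+Y_{\mathfrak{z}}$. The $j$-mapping $j:\mathfrak{z}\to\mathfrak{so}(\mathfrak{v},\langle\cdot,\cdot\rangle_{\mathfrak{v}})\subset\mathrm{End}(\mathfrak{v})$ is defined by $\langle j(Z)V,V'\rangle_{\mathfrak{v}}=\langle Z,[V,V']\rangle_{\mathfrak{z}}$. Coadjoint orbits. Identify $\mathfrak{g}\cong\mathfrak{g}^*$ via $Y\mapsto\langle Y,\cdot\rangle$. With $A^{\mathrm{T}}$ the adjoint of $A$ for $\langle\cdot,\cdot\rangle$, the coadjoint orbit through $Y$ is $\{(\mathrm{Ad}_q)^{\mathrm{T}}Y: q\in G\}$; its tangent space at $Y$ is $\{(\mathrm{ad}_U)^{\mathrm{T}}Y: U\in\mathfrak{g}\}=\mathrm{Im}\,j(Y_{\mathfrak{z}})$,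 and it carries the orbit symplectic form $\omega_Y((\mathrm{ad}_U)^{\mathrm{T}}Y,(\mathrm{ad}_{U'})^{\mathrm{T}}Y)=-\langle Y,[U,U']\rangle$. The reduced geodesic flow (Hamiltonian $h(Y)=\tfrac12\langle Y,Y\rangle$) is the Lie-Poisson equation in the claim; it restricts to a Hamiltonian system on each orbit $(\mathcal{O},\omega)$. Williamson type. Let $x$ be an equilibrium of a Hamiltonian system on a $2N$-dimensional symplectic manifold, and suppose all eigenvalues of the linearization of the Hamiltonian vector field at $x$ are non-zero. They consist of $2k_e$ purely imaginary numbers (pairs $\pm\mu_i\sqrt{-1}$), $2k_h$ real numbers (pairs $\pm\mu_r$) and $4k_f$ complex numbers (quadruples $\pm\mu_r\pm\mu_i\sqrt{-1}$), with $\mu_r,\mu_i\in\mathbb{R}\setminus\{0\}$; so $k_e+k_h+2k_f=N$. The Williamson type of $x$ is $(k_e,k_h,k_f)$. Conjugacy. Let $(p,q)$ be the signature of $\langle\cdot,\cdot\rangle_{\mathfrak{v}}$, where $p\le q$ is assumed without loss of generality, and identify $\mathfrak{so}(\mathfrak{v},\langle\cdot,\cdot\rangle_{\mathfrak{v}})$ with $\mathfrak{so}(p,q)$. ''Conjugate'' refers to the classification of Cartan subalgebras of $\mathfrak{so}(p,q)$ up to conjugacy (Sugiura), the families of matrices $M_A,M_B,M_C$ below being the ones used as representatives of conjugacy classes of Cartan subalgebras. All $h_i$ are real parameters, and for a diagonal matrix $\Delta$ write $R(\Delta)=\begin{pmatrix}0&-\Delta\\ \Delta&0\end{pmatrix}$.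 Matrix $M_A$ ($p+q=2n$, integers $k,\ell\ge0$, $2(k+\ell)\le p$): $$M_A=\begin{pmatrix} D_1+D_2&0&0&0&0&0&0\\ 0&D_4&0&0&-D_3&0&0\\ 0&0&0&0&0&-D_5&0\\ 0&0&0&D_1-D_2&0&0&0\\ 0&-D_3&0&0&D_4&0&0\\ 0&0&-D_5&0&0&0&0\\ 0&0&0&0&0&0&D_6\end{pmatrix},$$ with $D_1=R(\mathrm{diag}(h_1,\dots,h_\ell))$, $D_2=R(\mathrm{diag}(h_{\ell+1},\dots,h_{2\ell}))$, $D_3=\mathrm{diag}(h_{2\ell+1},\dots,h_{2\ell+k},h_{2\ell+1},\dots,h_{2\ell+k})$, $D_4=R(\mathrm{diag}(h_{2\ell+k+1},\dots,h_{2\ell+2k}))$, $D_5=\mathrm{diag}(h_{2\ell+2k+1},\dots,h_p)$, $D_6=R(\mathrm{diag}(h_{p+1},\dots,h_n))$. Matrix $M_B$ ($p=q=n$, $n$ even): $$M_B=\begin{pmatrix} D_4&0&-D_3&0\\ 0&D_5'+D_7&0&0\\ -D_3&0&D_4&0\\ 0&0&0&D_5'-D_7\end{pmatrix},$$ with $D_3=\mathrm{diag}(h_1,\dots,h_{(n-2)/2},h_1,\dots,h_{(n-2)/2})$, $D_4=R(\mathrm{diag}(h_{n/2},\dots,h_{n-2}))$, $D_5'=\mathrm{diag}(h_{n-1},-h_{n-1})$, $D_7=\begin{pmatrix}0&-h_n\\ h_n&0\end{pmatrix}$. Matrix $M_C$ ($p+q=2n+1$, integers $k,\ell\ge0$,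 $2(k+\ell)+1\le p$): $$M_C=\begin{pmatrix} D_1+D_2&0&0&0&0&0&0&0\\ 0&D_4&0&0&-D_3&0&0&0\\ 0&0&0&0&0&-D_5''&0&0\\ 0&0&0&D_1-D_2&0&0&0&0\\ 0&-D_3&0&0&D_4&0&0&0\\ 0&0&-D_5''&0&0&0&0&D_8/\sqrt2\\ 0&0&0&0&0&0&D_6&0\\ 0&0&0&0&0&-D_8^{\mathrm{T}}/\sqrt2&0&0\end{pmatrix},$$ with $D_1,D_2,D_3,D_4,D_6$ as in $M_A$, $D_5''=\mathrm{diag}(0,h_{2(\ell+k+1)},\dots,h_p)$ and $D_8=(h_{2\ell+2k+1},0,\dots,0)^{\mathrm{T}}\in\mathbb{R}^{p-2\ell-2k}$.
   Formalization: Two corrections: the entries of D_3, D_4 in (A), (C) and all h_i in (B) are assumed non-zero (else no complex quadruples arise); in M_B, the printed blocks D_5'+D_7, D_5'-D_7 become diagonal blocks D_7, -D_7 with D_5' off-diagonal in rows 2 and 4. *)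

(* Defs.v *)
From HB Require Import structures.
From mathcomp Require Import all_boot all_order all_algebra.
From mathcomp Require Import complex.
From mathcomp Require Import all_classical all_reals all_analysis.

Set Implicit Arguments.
Unset Strict Implicit.
Unset Printing Implicit Defensive.

Import Order.TTheory GRing.Theory Num.Theory.
Import numFieldNormedType.Exports.

Local Open Scope ring_scope.

Section Coordinates.
Variables (R : realType) (g : vectType R).

Definition gcoord : g -> 'rV[R]_(\dim {:g}) := passmx.rVof (vbasis {:g}).
Definition gvec : 'rV[R]_(\dim {:g}) -> g := passmx.vecof (vbasis {:g}).

End Coordinates.

Section LieGroup.
Variables (R : realType) (g : vectType R).
Variables (br : {bilinear g -> g -> g}) (form : {bilinear g -> g -> R | *%R & *%R}).

Definition lie_bracket : Prop :=
  (forall U, br U U = 0) /\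
  (forall U V W, br U (br V W) + br V (br W U) + br W (br U V) = 0).

Definition center (z : {vspace g}) : Prop :=
  forall Z, (Z \in z) <-> (forall U, br Z U = 0).

Definition step_two_nilpotent (z : {vspace g}) : Prop :=
  center z /\ (forall U V, br U V \in z).

Definition nondegenerate_on (U : {vspace g}) : Prop :=
  forall X, X \in U -> (forall Y, Y \in U -> form X Y = 0) -> X = 0.

Definition scalar_product : Prop :=
  (forall X Y, form X Y = form Y X) /\ nondegenerate_on fullv.

Definition orthogonal_complement (z v : {vspace g}) : Prop :=
  forall V, (V \in v) <-> (forall Z, Z \in z -> form V Z = 0).

(* Lie groups with Lie algebra g, exponential map expG and adjoint
   representation Ad.  As g is step-two nilpotent, the Baker-Campbell-Hausdorff
   series is U + U' + [U, U'] / 2 and holds globally, and the Lie group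
   structure is determined by the abstract group and expG: since the kernel of
   expG is discrete, expG is a chart near 0, and it is transported to the other
   points of G by translations; conjugations are smooth because they are linear
   in that chart.  G need not be connected. *)
Definition lie_group (G : groupType) (expG : g -> G) (Ad : G -> 'End(g)) : Prop :=
  [/\ forall U U', (expG U * expG U')%g = expG (U + U' + 2^-1 *: br U U'),
      exists2 e : R, 0 < e & forall U, `|gcoord U| < e -> expG U = 1%g -> U = 0
    & forall q U, (q * expG U * q^-1)%g = expG (Ad q U)].

(* Y' = (Ad_q)^T Y is expressed through the pairing with all V : g, which
   determines Y' by nondegeneracy; likewise for (ad_U)^T Y below. *)
Definition coadjoint_orbit (G : groupType) (Ad : G -> 'End(g)) (O : set g) : Prop :=
  exists Y, O = [set Y' | exists q, forall V, form Y' V = form Y (Ad q V)]%classic.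

Definition is_coad (U Y W : g) : Prop := forall V, form W V = form Y (br U V).

Definition orbit_tangent (Y : g) (T : {vspace g}) : Prop :=
  forall W, (W \in T) <-> (exists U, is_coad U Y W).

Variables (z v : {vspace g}).

Definition j_mapping (j : subvs_of z -> 'End(subvs_of v)) : Prop :=
  forall (Z : subvs_of z) (V V' : subvs_of v),
    form (vsval (j Z V)) (vsval V') = form (vsval Z) (br (vsval V) (vsval V')).

(* daddv_pi U U' is the projection onto U along U' *)
Definition lie_poisson (j : subvs_of z -> 'End(subvs_of v)) (Y : g) : g :=
  vsval (j (vsproj z (daddv_pi z v Y)) (vsproj v (daddv_pi v z Y))).

End LieGroup.

Section Williamson.
Variable R : realType.

(* the linearization at Y of the restriction of the vector field X to an
   immersed submanifold with tangent space T at Y: the differential of X at Y,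
   taken in coordinates, restricted to T *)
Definition linearization (g : vectType R) (X : g -> g) (Y : g)
    (T : {vspace g}) (L : 'End(subvs_of T)) : Prop :=
  let F := @gcoord R g \o X \o @gvec R g in
  differentiable F (gcoord Y) /\
  forall W, gcoord (vsval (L W)) = 'd F (gcoord Y) (gcoord (vsval W)).

(* s lists the eigenvalues with their algebraic multiplicities *)
Definition eigenvalues (V : vectType R) (L : 'End(V)) (s : seq R[i]) : Prop :=
  let e := vbasis {:V} in
  map_poly (real_complex R) (char_poly (passmx.mxof e e L)) = \prod_(x <- s) ('X - x%:P).

Local Open Scope complex_scope.

Definition elliptic_pair (m : R) : seq R[i] := [:: 0 +i* m; 0 +i* - m].

Definition hyperbolic_pair (m : R) : seq R[i] := [:: m%:C; (- m)%:C].

Definition focus_quadruple (m : R * R) : seq R[i] :=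
  [:: m.1 +i* m.2; m.1 +i* - m.2; - m.1 +i* m.2; - m.1 +i* - m.2].

Definition williamson_spectrum (s : seq R[i]) (ke kh kf : nat) : Prop :=
  exists (a : ke.-tuple R) (b : kh.-tuple R) (c : kf.-tuple (R * R)),
    [/\ all (fun m => m != 0) a, all (fun m => m != 0) b,
        all (fun m => (m.1 != 0) && (m.2 != 0)) c
      & perm_eq s (flatten (map elliptic_pair a) ++ flatten (map hyperbolic_pair b)
                   ++ flatten (map focus_quadruple c))].

Local Close Scope complex_scope.

Definition williamson_type (g : vectType R) (br : {bilinear g -> g -> g})
    (form : {bilinear g -> g -> R | *%R & *%R}) (X : g -> g) (Y : g)
    (ke kh kf : nat) : Prop :=
  X Y = 0 /\
  exists (T : {vspace g}) (L : 'End(subvs_of T)) (s : seq R[i]),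
    [/\ orbit_tangent br form Y T, linearization X Y L, eigenvalues L s
      & williamson_spectrum s ke kh kf].

End Williamson.

Section Conjugacy.
Variable R : realType.

Definition signature_mx (p q : nat) : 'M[R]_(p + q) := block_mx 1%:M 0 0 (- 1%:M).

(* A basis identifying so(v) with so(p, q).  The overall sign of the scalar
   product is left free: p <= q is arranged by changing it if necessary, which
   does not affect the j-mapping. *)
Definition pseudo_orthonormal (g : vectType R)
    (form : {bilinear g -> g -> R | *%R & *%R}) (v : {vspace g}) (p q : nat)
    (e : (p + q).-tuple (subvs_of v)) : Prop :=
  basis_of fullv e /\
  exists s : bool, forall i j,
    form (vsval (tnth e i)) (vsval (tnth e j)) = (-1) ^+ s * signature_mx p q i j.

(* the matrix acting on column vectors (passmx.mxof is its transpose) *)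
Definition end_mx (V : vectType R) (N : nat) (e : N.-tuple V) (f : 'End(V)) : 'M[R]_N :=
  \matrix_(i, j) coord e i (f (tnth e j)).

(* conjugacy by an element of O(p, q) *)
Definition conjugate_so (p q N : nat) (A : 'M[R]_(p + q)) (M : 'M[R]_N) : Prop :=
  exists (a : 'M[R]_(p + q)) (eqN : N = (p + q)%N),
    a^T *m signature_mx p q *m a = signature_mx p q /\
    A = a *m castmx (eqN, eqN) M *m invmx a.

End Conjugacy.

Section Representatives.
Variables (R : realType) (h : nat -> R).

Local Notation "A '//' B" := (col_mx A B) (at level 55, right associativity).
Local Notation "A '&&&' B" := (row_mx A B) (at level 53, right associativity).

(* diag(h_a, ..., h_{a + m - 1}) *)
Definition hdiag (a m : nat) : 'M[R]_m := diag_mx (\row_(i < m) h (a + i)).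

Definition Rmx (m : nat) (D : 'M[R]_m) : 'M[R]_(m + m) := block_mx 0 (- D) D 0.

Definition dbl (m : nat) (D : 'M[R]_m) : 'M[R]_(m + m) := block_mx D 0 0 D.

Definition D1 (l : nat) := Rmx (hdiag 1 l).
Definition D2 (l : nat) := Rmx (hdiag (l + 1) l).
Definition D3 (k l : nat) := dbl (hdiag (2 * l + 1) k).
Definition D4 (k l : nat) := Rmx (hdiag (2 * l + k + 1) k).
Definition D5 (p k l : nat) := hdiag (2 * l + 2 * k + 1) (p - 2 * l - 2 * k).
Definition D6 (n p : nat) := Rmx (hdiag (p + 1) (n - p)).


Definition sizeA (n p k l : nat) : nat :=
  let m := (p - 2 * l - 2 * k)%N in let r := (n - p)%N in
  ((l + l) + ((k + k) + (m + ((l + l) + ((k + k) + (m + (r + r)))))))%N.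

Definition mxA (n p k l : nat) : 'M[R]_(sizeA n p k l) :=
  let D1 := D1 l in let D2 := D2 l in let D3 := D3 k l in let D4 := D4 k l in
  let D5 := D5 p k l in let D6 := D6 n p in
  ((D1 + D2) &&& 0    &&& 0    &&& 0         &&& 0    &&& 0    &&& 0) //
  (0         &&& D4   &&& 0    &&& 0         &&& - D3 &&& 0    &&& 0) //
  (0         &&& 0    &&& 0    &&& 0         &&& 0    &&& - D5 &&& 0) //
  (0         &&& 0    &&& 0    &&& (D1 - D2) &&& 0    &&& 0    &&& 0) //
  (0         &&& - D3 &&& 0    &&& 0         &&& D4   &&& 0    &&& 0) //
  (0         &&& 0    &&& - D5 &&& 0         &&& 0    &&& 0    &&& 0) //
  (0         &&& 0    &&& 0    &&& 0         &&& 0    &&& 0    &&& D6).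

Definition sizeB (n : nat) : nat :=
  let m := ((n - 2) %/ 2)%N in ((m + m) + (2 + ((m + m) + 2)))%N.

Definition D5' (n : nat) : 'M[R]_(1 + 1) :=
  block_mx (h (n - 1))%:M 0 0 (- (h (n - 1))%:M).

Definition D7 (n : nat) : 'M[R]_(1 + 1) := Rmx (hdiag n 1).

(* The source prints the diagonal blocks D5' + D7 and D5' - D7 in place of
   D7, - D7 and the off-diagonal D5'.  That matrix lies in so(n, n) only if
   h_{n-1} = 0, and those blocks have the eigenvalues
   +-sqrt(h_{n-1}^2 - h_n^2), never +-h_{n-1} +- h_n i. *)
Definition mxB (n : nat) : 'M[R]_(sizeB n) :=
  let D3 := dbl (hdiag 1 ((n - 2) %/ 2)) in
  let D4 := Rmx (hdiag (n %/ 2) ((n - 2) %/ 2)) in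
  let D5' := D5' n in let D7 := D7 n in
  (D4   &&& 0   &&& - D3 &&& 0)   //
  (0    &&& D7  &&& 0    &&& D5') //
  (- D3 &&& 0   &&& D4   &&& 0)   //
  (0    &&& D5' &&& 0    &&& - D7).

Definition sizeC (n p k l : nat) : nat :=
  let m := (p - 2 * l - 2 * k)%N in let r := (n - p)%N in
  ((l + l) + ((k + k) + (m + ((l + l) + ((k + k) + (m + ((r + r) + 1)))))))%N.

Definition D5'' (p k l : nat) : 'M[R]_(p - 2 * l - 2 * k) :=
  diag_mx (\row_i (if val i == 0%N then 0 else h (2 * l + 2 * k + 1 + i))).

Definition D8 (p k l : nat) : 'cV[R]_(p - 2 * l - 2 * k) :=
  \col_i (if val i == 0%N then h (2 * l + 2 * k + 1) else 0).

Definition mxC (n p k l : nat) : 'M[R]_(sizeC n p k l) :=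
  let D1 := D1 l in let D2 := D2 l in let D3 := D3 k l in let D4 := D4 k l in
  let D5'' := D5'' p k l in let D6 := D6 n p in
  let E8 := (Num.sqrt 2)^-1 *: D8 p k l in
  ((D1 + D2) &&& 0    &&& 0      &&& 0         &&& 0    &&& 0       &&& 0  &&& 0)  //
  (0         &&& D4   &&& 0      &&& 0         &&& - D3 &&& 0       &&& 0  &&& 0)  //
  (0         &&& 0    &&& 0      &&& 0         &&& 0    &&& - D5''  &&& 0  &&& 0)  //
  (0         &&& 0    &&& 0      &&& (D1 - D2) &&& 0    &&& 0       &&& 0  &&& 0)  //
  (0         &&& - D3 &&& 0      &&& 0         &&& D4   &&& 0       &&& 0  &&& 0)  //
  (0         &&& 0    &&& - D5'' &&& 0         &&& 0    &&& 0       &&& 0  &&& E8) //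
  (0         &&& 0    &&& 0      &&& 0         &&& 0    &&& 0       &&& D6 &&& 0)  //
  (0         &&& 0    &&& 0      &&& 0         &&& 0    &&& - E8^T  &&& 0  &&& 0).

(* The parameters of D3 and D4 in mxA and mxC, which give the eigenvalues
   +-h_{2l+i} +- h_{2l+k+i} i: if one of them vanishes, these are real or purely
   imaginary although the rank may still be maximal. *)
Definition focus_parameters_neq0 (k l : nat) : Prop :=
  forall i, (2 * l < i <= 2 * l + 2 * k)%N -> h i != 0.

End Representatives.

(* Main.v *)
Require Import Defs.
From HB Require Import structures.
From mathcomp Require Import all_boot all_order all_algebra.
From mathcomp Require Import complex zify.
From mathcomp Require Import all_classical all_reals all_analysis.

Set Implicit Arguments.
Unset Strict Implicit.
Unset Printing Implicit Defensive.

Import Order.TTheory GRing.Theory Num.Theory.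
Import numFieldNormedType.Exports.

Local Open Scope ring_scope.

(** The linearization at the equilibrium is the restriction of j(Yz) to its own
    image, so the theorem is a computation of a characteristic polynomial.

    The vector field Y |-> j(Y_z) Y_v is the quadratic map of a bilinear map,
    whence its differential at Y sends W to j(W_z) Y_v + j(Y_z) W_v
    ([is_diff_quadratic]).  The tangent space of the orbit is the image of
    j(Y_z) ([orbit_tangent_image]); it lies in v, where the first term
    vanishes, so the linearization is j(Y_z) restricted to that image
    ([linearization_image]).

    Such a restriction is the product pi iota of two maps whose product
    iota pi in the other order is j(Y_z) itself.  As char(AB) and char(BA)
    differ by a power of X only, the restriction has the characteristic
    polynomial of any square matrix W of the size of the rank to which the
    matrix of j(Y_z) compresses, that is, with j(Y_z) = P W Q and Q P = 1
    ([char_poly_factorization]).  Compressions compose, and they cover at once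
    changes of basis, block permutations, and the removal of a zero row and
    column ([compresses_to]).

    The representatives compress to direct sums of blocks of three kinds: with
    R(y) the rotation block, R(y) alone gives eigenvalues +-iy, the block with
    off-diagonal entries -x gives +-x, and R(y) - x together with R(y) + x
    gives +-x +-iy; in the odd case the vector D8 adds one rotation block and
    a kernel line, which the compression discards.  The rank hypothesis says
    exactly that W is invertible, so that none of its eigenvalues vanishes and
    all elliptic and hyperbolic parameters are non-zero ([type_of_core]). *)

(** * Compressions of matrices *)

(** [A] is the direct sum of [B] and a zero matrix, up to similarity. The sizes
    are not related by an equation, so that this also compares matrices whose
    sizes agree only provably. *)
Definition compresses_to (F : fieldType) m n (A : 'M[F]_m) (B : 'M[F]_n) : Prop :=
  exists (P : 'M[F]_(m, n)) (Q : 'M[F]_(n, m)), Q *m P = 1%:M /\ A = P *m B *m Q.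

Definition dsum_mx (F : fieldType) m n (A : 'M[F]_m) (B : 'M[F]_n) :=
  block_mx A 0 0 B.

Section Compression.
Variable F : fieldType.

Lemma compresses_to_refl m (A : 'M[F]_m) : compresses_to A A.
Proof. by exists 1%:M, 1%:M; rewrite !mulmx1 mul1mx. Qed.

Lemma compresses_to_trans m n r (A : 'M[F]_m) (B : 'M[F]_n) (C : 'M[F]_r) :
  compresses_to A B -> compresses_to B C -> compresses_to A C.
Proof.
move=> [P [Q [QP ->]]] [P' [Q' [QP' ->]]]; exists (P *m P'), (Q' *m Q); split.
  by rewrite mulmxA -[Q' *m Q *m P]mulmxA QP mulmx1.
by rewrite !mulmxA.
Qed.

Lemma compresses_to_dsum m1 m2 n1 n2 (A1 : 'M[F]_m1) (A2 : 'M[F]_m2)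
    (B1 : 'M[F]_n1) (B2 : 'M[F]_n2) :
  compresses_to A1 B1 -> compresses_to A2 B2 ->
  compresses_to (dsum_mx A1 A2) (dsum_mx B1 B2).
Proof.
move=> [P [Q [QP ->]]] [P' [Q' [QP' ->]]].
exists (block_mx P 0 0 P'), (block_mx Q 0 0 Q').
rewrite /dsum_mx !mulmx_block !(mulmx0, mul0mx, addr0, add0r).
by rewrite QP QP' -scalar_mx_block.
Qed.

Lemma rank_compresses_to m n (A : 'M[F]_m) (B : 'M[F]_n) :
  compresses_to A B -> \rank A = \rank B.
Proof.
move=> [P [Q [QP ->]]]; apply/eqP; rewrite eqn_leq; apply/andP; split.
  exact: leq_trans (mxrankM_maxl _ _) (mxrankM_maxr _ _).
have {1}-> : B = Q *m (P *m B *m Q) *m P.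
  by rewrite !mulmxA QP mul1mx -mulmxA QP mulmx1.
exact: leq_trans (mxrankM_maxl _ _) (mxrankM_maxr _ _).
Qed.

Lemma char_poly_tr n (A : 'M[F]_n) : char_poly A^T = char_poly A.
Proof.
rewrite /char_poly -[in RHS]det_tr; congr (\det _).
by rewrite /char_poly_mx linearB/= tr_scalar_mx map_trmx.
Qed.

(** Let M be the block matrix with rows (X, A) and (B, 1). Clearing the block B
    by column operations gives det M = char(AB); clearing it by row operations,
    which multiply the determinant by X^n, gives X^m char(BA). *)
Lemma char_poly_mulC m n (A : 'M[F]_(m, n)) (B : 'M[F]_(n, m)) :
  'X^n * char_poly (A *m B) = 'X^m * char_poly (B *m A).
Proof.
rewrite /char_poly /char_poly_mx !map_mxM/=.
set a := map_mx _ A; set b := map_mx _ B.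
have E1 : block_mx ('X%:M : 'M[{poly F}]_m) a b (1%:M : 'M[{poly F}]_n)
    *m block_mx 1%:M 0 (- b) 1%:M = block_mx ('X%:M - a *m b) a 0 1%:M.
  by rewrite mulmx_block !(mulmx1, mul1mx, mulmx0, add0r, addr0) mulmxN subrr.
have E2 : block_mx (1%:M : 'M[{poly F}]_m) 0 (- b) ('X%:M : 'M[{poly F}]_n)
    *m block_mx 'X%:M a b 1%:M = block_mx 'X%:M a 0 ('X%:M - b *m a).
  rewrite mulmx_block !(mulmx1, mul1mx, mulmx0, mul0mx, add0r, addr0) !mulNmx.
  by rewrite mul_scalar_mx mul_mx_scalar addrC subrr addrC.
have /(congr1 determinant) := E1; have /(congr1 determinant) := E2.
rewrite !det_mulmx !det_ublock !det_lblock !det_scalar !expr1n !mul1r !mulr1.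
by move=> <- <-.
Qed.

Lemma char_poly_compresses_to m n (A : 'M[F]_m) (B : 'M[F]_n) :
  compresses_to A B -> 'X^n * char_poly A = 'X^m * char_poly B.
Proof.
by move=> [P [Q [QP ->]]]; rewrite -mulmxA char_poly_mulC -mulmxA QP mulmx1.
Qed.

Lemma char_poly_dsum m n (A : 'M[F]_m) (B : 'M[F]_n) :
  char_poly (dsum_mx A B) = char_poly A * char_poly B.
Proof.
rewrite /char_poly /char_poly_mx map_block_mx !map_mx0 scalar_mx_block.
by rewrite opp_block_mx add_block_mx !oppr0 !addr0 det_ublock.
Qed.

Lemma unitmx_compresses_to m n (A : 'M[F]_m) (B : 'M[F]_n) :
  compresses_to A B -> \rank A = n -> B \in unitmx.
Proof.
by move/rank_compresses_to=> ->; rewrite -row_free_unit -row_leq_rank => ->.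
Qed.

End Compression.

(** * Splitting block matrices into direct sums *)

Section Blocks.
Variable F : numFieldType.

Local Notation "A '//' B" := (col_mx A B) (at level 55, right associativity).
Local Notation "A '&&&' B" := (row_mx A B) (at level 53, right associativity).
Lemma mul_col_row1 m n1 n2 (Q1 : 'M[F]_(n1, m)) (Q2 : 'M[F]_(n2, m))
    (P1 : 'M[F]_(m, n1)) (P2 : 'M[F]_(m, n2)) :
  Q1 *m P1 = 1%:M -> Q1 *m P2 = 0 -> Q2 *m P1 = 0 -> Q2 *m P2 = 1%:M ->
  (Q1 // Q2) *m (P1 &&& P2) = 1%:M.
Proof.
by move=> e1 e2 e3 e4; rewrite mul_col_row e1 e2 e3 e4 -scalar_mx_block.
Qed.

Lemma mul_mx_row0 m n p1 p2 (A : 'M[F]_(m, n)) (B : 'M[F]_(n, p1))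
    (C : 'M[F]_(n, p2)) :
  A *m B = 0 -> A *m C = 0 -> A *m (B &&& C) = 0.
Proof. by move=> e1 e2; rewrite mul_mx_row e1 e2 row_mx0. Qed.

Lemma mul_col_mx0 m1 m2 n p (A : 'M[F]_(m1, n)) (B : 'M[F]_(m2, n))
    (C : 'M[F]_(n, p)) :
  A *m C = 0 -> B *m C = 0 -> (A // B) *m C = 0.
Proof. by move=> e1 e2; rewrite mul_col_mx e1 e2 col_mx0. Qed.

Lemma row_mx_col_mx m1 m2 n1 n2 (A : 'M[F]_(m1, n1)) (B : 'M[F]_(m1, n2))
    (C : 'M[F]_(m2, n1)) (D : 'M[F]_(m2, n2)) :
  (A // C) &&& (B // D) = (A &&& B) // (C &&& D).
Proof. by rewrite -block_mxEh -block_mxEv. Qed.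

Lemma col_row_mx0 m1 m2 n1 n2 (A : 'M[F]_(m1, n1)) (B : 'M[F]_(m1, n2)) :
  (A &&& B) // 0 = (A // (0 : 'M[F]_(m2, n1))) &&& (B // 0).
Proof. by rewrite row_mx_col_mx row_mx0. Qed.

Lemma col_0_row_mx m1 m2 n1 n2 (A : 'M[F]_(m2, n1)) (B : 'M[F]_(m2, n2)) :
  0 // (A &&& B) = ((0 : 'M[F]_(m1, n1)) // A) &&& (0 // B).
Proof. by rewrite row_mx_col_mx row_mx0. Qed.

(** The factor 2 allows for bases whose vectors are not normalized, such as the
    sums and differences used below. *)
Lemma compresses_to_intertwined n (A B P P' : 'M[F]_n) :
  P *m P' = 2%:M -> A *m P = P *m B -> compresses_to A B.
Proof.
move=> PP' AP; have PQ : P *m (2^-1 *: P') = 1%:M.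
  by rewrite -scalemxAr PP' scale_scalar_mx mulVf// pnatr_eq0.
by exists P, (2^-1 *: P'); rewrite (mulmx1C PQ) -AP -mulmxA PQ mulmx1.
Qed.

(** The diagonal and the antidiagonal are the invariant subspaces. *)
Lemma compresses_to_symmetric m (D E : 'M[F]_m) :
  compresses_to (block_mx D (- E) (- E) D) (dsum_mx (D - E) (D + E)).
Proof.
pose P : 'M[F]_(m + m) := block_mx 1%:M 1%:M 1%:M (- 1%:M).
apply: (@compresses_to_intertwined _ _ _ P P).
  rewrite mulmx_block !(mulmx1, mul1mx, mulmxN, mulNmx) opprK subrr.
  by rewrite -raddfD/= -scalar_mx_block.
rewrite /dsum_mx !mulmx_block !(mulmx1, mul1mx, mulmxN, mulNmx, mulmx0, mul0mx).
by rewrite !oppr0 !(addr0, add0r) opprK [- E + D]addrC opprD [- E - D]addrC.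
Qed.

(** If [i] is a square root of -1, the graphs of [- i] and [i] are invariant. *)
Lemma compresses_to_conj (i : F) m (X Y : 'M[F]_m) :
  i * i = -1 ->
  compresses_to (block_mx X (- Y) Y X) (dsum_mx (X + i *: Y) (X - i *: Y)).
Proof.
move=> ii.
pose P : 'M[F]_(m + m) := block_mx 1%:M 1%:M (- i%:M) i%:M.
apply: (@compresses_to_intertwined _ _ _ P (block_mx 1%:M i%:M 1%:M (- i%:M))).
  rewrite mulmx_block !(mulmx1, mul1mx, mulmxN, mulNmx) -!scalar_mxM ii.
  by rewrite raddfN/= opprK subrr addNr -!raddfD/= -scalar_mx_block.
rewrite /dsum_mx !mulmx_block !(mulmx1, mul1mx, mulmxN, mulNmx, mulmx0, mul0mx).
rewrite !mul_mx_scalar !mul_scalar_mx !(addr0, add0r) oppr0 add0r.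
rewrite !(scalerDr, scalerN) scalerA ii scaleN1r !opprB opprK.
by rewrite !opprK [i *: X + Y]addrC.
Qed.

(** The graphs of [- S] and [S] are invariant, because the involution [S]
    anticommutes with [J] and commutes with [K]. The summands have the
    same form as in [compresses_to_symmetric], which is why the blocks D7 and
    D5' contribute a focus quadruple. *)
Lemma compresses_to_cross m (J K S : 'M[F]_m) :
  S *m S = 1%:M -> S *m J = - (J *m S) -> S *m K = K *m S ->
  compresses_to (block_mx J K K (- J)) (dsum_mx (J - K *m S) (J + K *m S)).
Proof.
move=> SS SJ SK.
pose P : 'M[F]_(m + m) := block_mx 1%:M 1%:M (- S) S.
apply: (@compresses_to_intertwined _ _ _ P (block_mx 1%:M (- S) 1%:M S)).
  rewrite mulmx_block !(mulmx1, mul1mx, mulmxN, mulNmx) SS.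
  by rewrite opprK addNr -raddfD/= -scalar_mx_block.
rewrite /dsum_mx !mulmx_block !(mulmx1, mul1mx, mulmxN, mulNmx, mulmx0, mul0mx).
rewrite !(addr0, add0r) !opprK mulmxBr mulmxDr SJ !mulmxA SK -!mulmxA SS mulmx1.
by rewrite oppr0 add0r opprB opprK [- _ + K]addrC.
Qed.

(** The two blocks of size [b] interact only with each other, and those of size
    [c] only with each other and with the tail of size [t]; [P] and [Q] are the
    block permutation matrices that gather them. *)
Lemma compresses_to_unshuffle a b c t (A A' : 'M[F]_a) (B B1 B2 B' : 'M[F]_b)
   (C C1 C2 C' : 'M[F]_c) (U U' : 'M[F]_(c, t)) (V V' : 'M[F]_(t, c)) (T : 'M[F]_t) :
 compresses_to
  ((A &&& 0 &&& 0  &&& 0  &&& 0  &&& 0  &&& 0) //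
  (0 &&& B  &&& 0  &&& 0  &&& B1 &&& 0  &&& 0) //
  (0 &&& 0  &&& C  &&& 0  &&& 0  &&& C1 &&& U) //
  (0 &&& 0  &&& 0  &&& A' &&& 0  &&& 0  &&& 0) //
  (0 &&& B2 &&& 0  &&& 0  &&& B' &&& 0  &&& 0) //
  (0 &&& 0  &&& C2 &&& 0  &&& 0  &&& C' &&& U') //
  (0 &&& 0  &&& V  &&& 0  &&& 0  &&& V' &&& T))
  (dsum_mx A (dsum_mx A' (dsum_mx (block_mx B B1 B2 B')
     ((C &&& C1 &&& U) // (C2 &&& C' &&& U') // (V &&& V' &&& T))))).
Proof.
pose Pa : 'M[F]_(a + (b + (c + (a + (b + (c + t))))), a) :=
  1%:M // 0 // 0 // 0 // 0 // 0 // 0.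
pose Pa' : 'M[F]_(a + (b + (c + (a + (b + (c + t))))), a) :=
  0 // 0 // 0 // 1%:M // 0 // 0 // 0.
pose Pb : 'M[F]_(a + (b + (c + (a + (b + (c + t))))), b + b) :=
  0 // (1%:M &&& 0) // 0 // 0 // (0 &&& 1%:M) // 0 // 0.
pose Pc : 'M[F]_(a + (b + (c + (a + (b + (c + t))))), c + (c + t)) :=
  0 // 0 // (1%:M &&& 0 &&& 0) // 0 // 0 //
    (0 &&& 1%:M &&& 0) // (0 &&& 0 &&& 1%:M).
pose Qa : 'M[F]_(a, a + (b + (c + (a + (b + (c + t)))))) :=
  1%:M &&& 0 &&& 0 &&& 0 &&& 0 &&& 0 &&& 0.
pose Qa' : 'M[F]_(a, a + (b + (c + (a + (b + (c + t)))))) :=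
  0 &&& 0 &&& 0 &&& 1%:M &&& 0 &&& 0 &&& 0.
pose Qb : 'M[F]_(b + b, a + (b + (c + (a + (b + (c + t)))))) :=
  0 &&& (1%:M // 0) &&& 0 &&& 0 &&& (0 // 1%:M) &&& 0 &&& 0.
pose Qc : 'M[F]_(c + (c + t), a + (b + (c + (a + (b + (c + t)))))) :=
  0 &&& 0 &&& (1%:M // 0 // 0) &&& 0 &&& 0 &&&
    (0 // 1%:M // 0) &&& (0 // 0 // 1%:M).
exists (Pa &&& Pa' &&& Pb &&& Pc), (Qa // Qa' // Qb // Qc).
split.
  do 3?[apply: mul_col_row1]; do ?[apply: mul_col_mx0]; do ?[apply: mul_mx_row0];
  rewrite /Pa /Pa' /Pb /Pc /Qa /Qa' /Qb /Qc !mul_row_col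
   ?(mulmx0, mul0mx, mulmx1, mul1mx, add0r, addr0)// ?mul_col_row ?mulmx0 ?mul0mx ?mulmx1
   ?add_block_mx ?(add0r, addr0, block_mx0) -?scalar_mx_block//.
  by rewrite row_mx0 mulmx0 col_mx0 -scalar_mx_block.
rewrite /dsum_mx.
rewrite (mul_row_block _ _ A) !mulmx0 ?(add0r, addr0) mul_row_col.
rewrite (mul_row_block _ _ A') !mulmx0 ?(add0r, addr0) mul_row_col.
rewrite (mul_row_block _ _ _ 0) !mulmx0 ?(add0r, addr0) mul_row_col.
have -> : Pa *m A *m Qa = (A &&& 0 &&& 0 &&& 0 &&& 0 &&& 0 &&& 0) // 0.
  by rewrite !mul_col_mx !mul0mx mul1mx !mul_mx_row !mulmx0 mulmx1 !col_mx0.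
have -> : Pa' *m A' *m Qa' =
    0 // 0 // 0 // (0 &&& 0 &&& 0 &&& A' &&& 0 &&& 0 &&& 0) // 0.
  by rewrite !mul_col_mx !mul0mx mul1mx !mul_mx_row !mulmx0 mulmx1 !col_mx0.
have -> : Pb *m block_mx B B1 B2 B' *m Qb =
    0 // (0 &&& B &&& 0 &&& 0 &&& B1 &&& 0 &&& 0) // 0 //
    0 // (0 &&& B2 &&& 0 &&& 0 &&& B' &&& 0 &&& 0) // 0.
  rewrite !mul_col_mx !mul0mx !mul_row_block !mul0mx !mul1mx ?(add0r, addr0).
  rewrite !mul_mx_row !mul_row_col.
  by rewrite !mulmx0 !mulmx1 !(add0r, addr0) !col_mx0.
have -> : Pc *m ((C &&& C1 &&& U) // (C2 &&& C' &&& U') //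
      (V &&& V' &&& T)) *m Qc =
    0 // 0 // (0 &&& 0 &&& C &&& 0 &&& 0 &&& C1 &&& U) //
    0 // 0 // (0 &&& 0 &&& C2 &&& 0 &&& 0 &&& C' &&& U') //
    (0 &&& 0 &&& V &&& 0 &&& 0 &&& V' &&& T).
  rewrite !mul_col_mx !mul0mx !mul_row_col !mul0mx !mul1mx ?(add0r, addr0).
  rewrite !mul_mx_row !mul_row_col.
  by rewrite !mulmx0 !mulmx1 !(add0r, addr0).
by rewrite ?(add_col_mx, add0r, addr0).
Qed.

(** The case where the tail consists of the block [G] and of one further
    coordinate, which interacts with the second block of size [c]. *)
Lemma compresses_to_unshuffle_odd a b c g (A A' : 'M[F]_a) (D E : 'M[F]_b) (C : 'M[F]_c)
    (e : 'cV[F]_c) (G : 'M[F]_g) :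
 compresses_to
  ((A &&& 0    &&& 0    &&& 0  &&& 0    &&& 0    &&& 0 &&& 0) //
  (0  &&& D    &&& 0    &&& 0  &&& - E  &&& 0    &&& 0 &&& 0) //
  (0  &&& 0    &&& 0    &&& 0  &&& 0    &&& - C  &&& 0 &&& 0) //
  (0  &&& 0    &&& 0    &&& A' &&& 0    &&& 0    &&& 0 &&& 0) //
  (0  &&& - E  &&& 0    &&& 0  &&& D    &&& 0    &&& 0 &&& 0) //
  (0  &&& 0    &&& - C  &&& 0  &&& 0    &&& 0    &&& 0 &&& e) //
  (0  &&& 0    &&& 0    &&& 0  &&& 0    &&& 0    &&& G &&& 0) //
  (0  &&& 0    &&& 0    &&& 0  &&& 0    &&& - e^T &&& 0 &&& 0))
  (dsum_mx A (dsum_mx A' (dsum_mx (block_mx D (- E) (- E) D)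
     ((0 &&& - C &&& 0) // (- C &&& 0 &&& (0 &&& e)) //
      (0 &&& (0 // - e^T) &&& block_mx G 0 0 (0 : 'M[F]_1)))))).
Proof.
have := compresses_to_unshuffle A A' D (- E) (- E) D 0 (- C) (- C) 0
  0 (0 &&& e) 0 (0 // - e^T) (block_mx G 0 0 (0 : 'M[F]_1)).
congr (compresses_to _ _).
(* the last two block rows and columns are merged into the tail *)
have zr r : 0 = (0 : 'M[F]_(r, g)) &&& (0 : 'M[F]_(r, 1)) by rewrite row_mx0.
have zc r : 0 = (0 : 'M[F]_(g, r)) // (0 : 'M[F]_(1, r)) by rewrite col_mx0.
by rewrite /block_mx !zr !zc !row_mx_col_mx.
Qed.

Lemma compresses_to_even_core c t (C C1 C2 C' : 'M[F]_c) (T : 'M[F]_t) :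
  compresses_to ((C &&& C1 &&& 0) // (C2 &&& C' &&& 0) // (0 &&& 0 &&& T))
    (dsum_mx (block_mx C C1 C2 C') T).
Proof.
pose P1 : 'M[F]_(c + (c + t), c + c) := (1%:M &&& 0) // (0 &&& 1%:M) // 0.
pose P2 : 'M[F]_(c + (c + t), t) := 0 // 0 // 1%:M.
pose Q1 : 'M[F]_(c + c, c + (c + t)) := (1%:M // 0) &&& (0 // 1%:M) &&& 0.
pose Q2 : 'M[F]_(t, c + (c + t)) := 0 &&& 0 &&& 1%:M.
exists (P1 &&& P2), (Q1 // Q2); split.
  apply: mul_col_row1; rewrite !mul_row_col ?mul_col_row
    ?(mulmx0, mul0mx, mulmx1, mul1mx, add0r, addr0)//.
  by rewrite add_block_mx !(add0r, addr0) -scalar_mx_block.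
rewrite /dsum_mx (mul_row_block _ _ _ 0) !mulmx0 ?(add0r, addr0) mul_row_col.
have -> : P1 *m block_mx C C1 C2 C' *m Q1 =
    (C &&& C1 &&& 0) // (C2 &&& C' &&& 0) // 0.
  rewrite !mul_col_mx !mul0mx !mul_row_block !mul0mx !mul1mx ?(add0r, addr0).
  by rewrite !mul_mx_row !mul_row_col !mulmx0 !mulmx1 !(add0r, addr0).
have -> : P2 *m T *m Q2 = 0 // 0 // (0 &&& 0 &&& T).
  by rewrite !mul_col_mx !mul0mx mul1mx !mul_mx_row !mulmx0 mulmx1.
by rewrite ?(add_col_mx, add0r, addr0).
Qed.

(** The first coordinate of the first block is in the kernel on both sides, and
    [P] omits it; the first coordinate of the second block pairs with the last
    coordinate into a rotation block. *)
Lemma compresses_to_odd_core m g (D : 'M[F]_m) (x : F) (G : 'M[F]_g) :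
  let C : 'M[F]_(1 + m) := - block_mx 0 0 0 D in
  let E : 'cV[F]_(1 + m) := x%:M // 0 in
  compresses_to ((0 &&& C &&& 0) // (C &&& 0 &&& (0 &&& E)) //
      (0 &&& (0 // - E^T) &&& block_mx G 0 0 (0 : 'M[F]_1)))
    (dsum_mx (block_mx 0 x%:M (- x%:M : 'M[F]_1) 0)
      (dsum_mx (block_mx 0 (- D) (- D) 0) G)).
Proof.
move=> C E.
pose P1 : 'M[F]_((1 + m) + ((1 + m) + (g + 1)), 1 + 1) :=
  0 // ((1%:M &&& 0) // 0) // (0 // (0 &&& 1%:M)).
pose P2 : 'M[F]_((1 + m) + ((1 + m) + (g + 1)), m + m) :=
  (0 // (1%:M &&& 0)) // (0 // (0 &&& 1%:M)) // 0.
pose P3 : 'M[F]_((1 + m) + ((1 + m) + (g + 1)), g) := 0 // 0 // (1%:M // 0).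
pose Q1 : 'M[F]_(1 + 1, (1 + m) + ((1 + m) + (g + 1))) :=
  0 &&& ((1%:M // 0) &&& 0) &&& (0 &&& (0 // 1%:M)).
pose Q2 : 'M[F]_(m + m, (1 + m) + ((1 + m) + (g + 1))) :=
  (0 &&& (1%:M // 0)) &&& (0 &&& (0 // 1%:M)) &&& 0.
pose Q3 : 'M[F]_(g, (1 + m) + ((1 + m) + (g + 1))) := 0 &&& 0 &&& (1%:M &&& 0).
exists (P1 &&& P2 &&& P3), (Q1 // Q2 // Q3); split.
  do 2?[apply: mul_col_row1]; do ?[apply: mul_col_mx0]; do ?[apply: mul_mx_row0];
    rewrite /P1 /P2 /P3 /Q1 /Q2 /Q3 !mul_row_col
      ?(mulmx0, mul0mx, mulmx1, mul1mx, add0r, addr0)// ?mul_row_col ?mul_col_row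
      ?(mulmx0, mul0mx, mulmx1, mul1mx, add0r, addr0)//
      ?add_block_mx ?(add0r, addr0) -?scalar_mx_block//.
rewrite /dsum_mx (mul_row_block P1) !mulmx0 ?(add0r, addr0) mul_row_col.
rewrite (mul_row_block _ _ _ 0) !mulmx0 ?(add0r, addr0) mul_row_col.
have -> : P1 *m block_mx 0 x%:M (- x%:M : 'M[F]_1) 0 *m Q1 =
    0 // (0 &&& 0 &&& (0 &&& E)) // (0 &&& (0 // - E^T) &&& 0).
  rewrite !mul_col_mx !mul0mx !mul_row_block !mul0mx !mul1mx ?(add0r, addr0).
  rewrite !mul_mx_row !mul_row_col !mulmx0 !mulmx1 !(add0r, addr0).
  rewrite /E tr_col_mx tr_scalar_mx trmx0 opp_row_mx oppr0.
  by rewrite /block_mx !(row_mx0, col_row_mx0, col_0_row_mx, col_mx0).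
have -> : P2 *m block_mx 0 (- D) (- D) 0 *m Q2 =
    (0 &&& C &&& 0) // (C &&& 0 &&& 0) // 0.
  rewrite !mul_col_mx !mul0mx !mul_row_block !mul0mx !mul1mx ?(add0r, addr0).
  rewrite !mul_mx_row !mul_row_col !mulmx0 !mulmx1 !(add0r, addr0).
  rewrite /C opp_block_mx !oppr0.
  by rewrite /block_mx !(row_mx0, col_row_mx0, col_0_row_mx, col_mx0).
have -> : P3 *m G *m Q3 = 0 // 0 // (0 &&& 0 &&& block_mx G 0 0 (0 : 'M[F]_1)).
  rewrite !mul_col_mx !mul0mx mul1mx !mul_mx_row !mulmx0 mulmx1.
  by rewrite /block_mx !(row_mx0, col_row_mx0, col_0_row_mx, col_mx0).
by rewrite ?(add_col_mx, add_row_mx, add0r, addr0).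
Qed.

Lemma compresses_to_unshuffle4 b d (B B1 B2 B' : 'M[F]_b) (D D1 D2 D' : 'M[F]_d) :
  compresses_to
   ((B  &&& 0  &&& B1 &&& 0)   //
    (0  &&& D  &&& 0  &&& D1) //
    (B2 &&& 0  &&& B' &&& 0)   //
    (0  &&& D2 &&& 0  &&& D'))
   (dsum_mx (block_mx B B1 B2 B') (block_mx D D1 D2 D')).
Proof.
pose P1 : 'M[F]_(b + (d + (b + d)), b + b) := (1%:M &&& 0) // 0 // (0 &&& 1%:M) // 0.
pose P2 : 'M[F]_(b + (d + (b + d)), d + d) := 0 // (1%:M &&& 0) // 0 // (0 &&& 1%:M).
pose Q1 : 'M[F]_(b + b, b + (d + (b + d))) := (1%:M // 0) &&& 0 &&& (0 // 1%:M) &&& 0.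
pose Q2 : 'M[F]_(d + d, b + (d + (b + d))) := 0 &&& (1%:M // 0) &&& 0 &&& (0 // 1%:M).
exists (P1 &&& P2), (Q1 // Q2); split.
  apply: mul_col_row1; rewrite !mul_row_col ?mul_col_row
    ?(mulmx0, mul0mx, mulmx1, mul1mx, add0r, addr0)//;
  by rewrite add_block_mx !(add0r, addr0) -scalar_mx_block.
rewrite /dsum_mx (mul_row_block _ _ _ 0) !mulmx0 ?(add0r, addr0) mul_row_col.
have -> : P1 *m block_mx B B1 B2 B' *m Q1 =
    (B &&& 0 &&& B1 &&& 0) // 0 // (B2 &&& 0 &&& B' &&& 0) // 0.
  rewrite !mul_col_mx !mul0mx !mul_row_block !mul0mx !mul1mx ?(add0r, addr0).
  by rewrite !mul_mx_row !mul_row_col !mulmx0 !mulmx1 !(add0r, addr0).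
have -> : P2 *m block_mx D D1 D2 D' *m Q2 =
    0 // (0 &&& D &&& 0 &&& D1) // 0 // (0 &&& D2 &&& 0 &&& D').
  rewrite !mul_col_mx !mul0mx !mul_row_block !mul0mx !mul1mx ?(add0r, addr0).
  by rewrite !mul_mx_row !mul_row_col !mulmx0 !mulmx1 !(add0r, addr0).
by rewrite ?(add_col_mx, add0r, addr0).
Qed.
End Blocks.

(** * Spectra of the diagonal blocks *)

Section Spectrum.
Variable R : realType.

(** Non-vanishing is part of the property for the focus parameters alone: for
    the other two kinds it is equivalent to invertibility of the matrix, but
    the matrix stays invertible if one of the two parameters of a focus block
    vanishes. *)
Definition has_spectrum N (W : 'M[R]_N) (ke kh kf : nat) : Prop :=
  exists (a : ke.-tuple R) (b : kh.-tuple R) (c : kf.-tuple (R * R)),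
    all (fun m => (m.1 != 0) && (m.2 != 0)) c /\
    map_poly (real_complex R) (char_poly W) =
      \prod_(x <- flatten (map (@elliptic_pair R) a)
                  ++ flatten (map (@hyperbolic_pair R) b)
                  ++ flatten (map (@focus_quadruple R) c)) ('X - x%:P).

Lemma has_spectrum_dsum m n (A : 'M[R]_m) (B : 'M[R]_n) ke kh kf ke' kh' kf' :
  has_spectrum A ke kh kf -> has_spectrum B ke' kh' kf' ->
  has_spectrum (dsum_mx A B) (ke + ke') (kh + kh') (kf + kf').
Proof.
move=> [a [b [c [hc hA]]]] [a' [b' [c' [hc' hB]]]].
exists (cat_tuple a a'), (cat_tuple b b'), (cat_tuple c c'); split.
  by rewrite all_cat hc.
rewrite char_poly_dsum rmorphM/= hA hB !map_cat !flatten_cat !big_cat/=.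
by rewrite mulrACA; congr (_ * _); rewrite mulrACA.
Qed.

Lemma has_spectrum_compress m (A B : 'M[R]_m) ke kh kf :
  compresses_to A B -> has_spectrum B ke kh kf -> has_spectrum A ke kh kf.
Proof.
move=> /char_poly_compresses_to/mulfI E [a [b [c [hc h]]]]; exists a, b, c; split=> //.
by rewrite -h E// expf_neq0 ?polyX_eq0.
Qed.

Let i : R[i] := (0 +i* 1)%C.

Let ii : i * i = -1.
Proof.
by apply/eqP; rewrite /i eq_complex/= !(mulr0, mulr1, sub0r, addr0) oppr0 !eqxx.
Qed.

Lemma char_poly_rotation m (x y : 'rV[R]_m) :
  map_poly (real_complex R)
    (char_poly (block_mx (diag_mx x) (- diag_mx y) (diag_mx y) (diag_mx x))) =
  \prod_j (('X - (x 0 j +i* y 0 j)%C%:P) * ('X - (x 0 j +i* - y 0 j)%C%:P)).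
Proof.
pose X := map_mx (real_complex R) (diag_mx x).
pose Y := map_mx (real_complex R) (diag_mx y).
have C := compresses_to_conj X Y ii.
rewrite map_char_poly map_block_mx map_mxN /= -/X -/Y.
have := char_poly_compresses_to C => /mulfI ->; last by rewrite expf_neq0 ?polyX_eq0.
rewrite char_poly_dsum !char_poly_trig.
- rewrite -big_split/=; apply: eq_bigr => j _.
  have E (u v : R) : (u +i* v)%C = (u%:C)%C + i * (v%:C)%C.
    apply/eqP; rewrite eq_complex/= !(mul0r, mulr0, mul1r).
    by rewrite !(addr0, subr0, add0r) !eqxx.
  by rewrite !mxE eqxx !mulr1n !E rmorphN mulrN.
- apply/is_trig_mxP => j k /ltn_eqF jk.
  by rewrite !mxE -val_eqE/= jk !mulr0n rmorph0 mulr0 subr0.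
- apply/is_trig_mxP => j k /ltn_eqF jk.
  by rewrite !mxE -val_eqE/= jk !mulr0n rmorph0 mulr0 addr0.
Qed.

Lemma has_spectrum_elliptic m (y : 'rV[R]_m) :
  has_spectrum (Rmx (diag_mx y)) m 0 0.
Proof.
exists [tuple y 0 j | j < m], [tuple], [tuple]; split=> //=.
rewrite cats0 big_flatten/= big_map big_image/=.
have := @char_poly_rotation m 0 y; rewrite linear0 => ->.
by apply: eq_bigr => j _; rewrite !mxE big_cons big_seq1.
Qed.

Lemma char_poly_diag (F : fieldType) m (x : 'rV[F]_m) :
  char_poly (diag_mx x) = \prod_j ('X - (x 0 j)%:P).
Proof.
rewrite char_poly_trig; last first.
  by apply/is_trig_mxP => j k /ltn_eqF jk; rewrite mxE -val_eqE/= jk.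
by apply: eq_bigr => j _; rewrite mxE eqxx mulr1n.
Qed.

Lemma has_spectrum_hyperbolic m (x : 'rV[R]_m) :
  has_spectrum (block_mx 0 (- diag_mx x) (- diag_mx x) 0) 0 m 0.
Proof.
apply: has_spectrum_compress (compresses_to_symmetric _ _) _.
exists [tuple], [tuple x 0 j | j < m], [tuple]; split=> //=.
rewrite cats0 big_flatten/= big_map big_image/= char_poly_dsum sub0r add0r.
rewrite -raddfN/= !char_poly_diag rmorphM/= !rmorph_prod -big_split/=.
apply: eq_bigr => j _; rewrite !mxE big_cons big_seq1 mulrC.
by rewrite !rmorphB/= !map_polyX !map_polyC.
Qed.

Lemma has_spectrum_focus m (x y : 'rV[R]_m) :
  (forall j, x 0 j != 0) -> (forall j, y 0 j != 0) ->
  has_spectrum (dsum_mx (Rmx (diag_mx y) - dbl (diag_mx x))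
                        (Rmx (diag_mx y) + dbl (diag_mx x))) 0 0 m.
Proof.
move=> hx hy; exists [tuple], [tuple], [tuple (x 0 j, y 0 j) | j < m]; split.
  by apply/all_tnthP => j; rewrite tnth_mktuple hx hy.
rewrite /= big_flatten/= big_map big_image/= char_poly_dsum.
rewrite /Rmx /dbl opp_block_mx !add_block_mx !oppr0 !(addr0, add0r) -raddfN/=.
rewrite rmorphM/= !char_poly_rotation -big_split/=.
apply: eq_bigr => j _; rewrite !mxE !big_cons big_nil mulr1/=.
by rewrite mulrC !mulrA.
Qed.

End Spectrum.

(** * Compressing the representatives *)

Section Cores.
Variable R : realType.

(** The equation on the size [N] is propositional because [N] is the sum of the
    block sizes. *)
Definition has_core M (A : 'M[R]_M) r ke kh kf : Prop :=
  exists N (W : 'M[R]_N), [/\ N = r, compresses_to A W & has_spectrum W ke kh kf].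

Lemma Rmx_diagD m (x y : 'rV[R]_m) :
  Rmx (diag_mx x) + Rmx (diag_mx y) = Rmx (diag_mx (x + y)).
Proof. by rewrite /Rmx add_block_mx !addr0 linearD opprD. Qed.

Lemma Rmx_diagB m (x y : 'rV[R]_m) :
  Rmx (diag_mx x) - Rmx (diag_mx y) = Rmx (diag_mx (x - y)).
Proof.
rewrite /Rmx opp_block_mx add_block_mx !oppr0 !addr0.
by rewrite linearB/= opprB opprK addrC.
Qed.

Variable h : nat -> R.

Lemma has_spectrum_D1D2 l :
  has_spectrum (D1 h l + D2 h l) l 0 0 /\ has_spectrum (D1 h l - D2 h l) l 0 0.
Proof.
by rewrite /D1 /D2 /hdiag Rmx_diagD Rmx_diagB; split; apply: has_spectrum_elliptic.
Qed.

Lemma has_spectrum_D3D4 k l : focus_parameters_neq0 h k l ->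
  has_spectrum (dsum_mx (D4 h k l - D3 h k l) (D4 h k l + D3 h k l)) 0 0 k.
Proof.
move=> hf; apply: has_spectrum_focus => j; rewrite mxE; apply: hf;
  by have := ltn_ord j; lia.
Qed.

Lemma mxA_core n p k l :
  focus_parameters_neq0 h k l -> (2 * (k + l) <= p <= n)%N ->
  has_core (mxA h n p k l) (2 * n) (2 * l + n - p) (p - 2 * l - 2 * k) k.
Proof.
move=> hf hp.
have C := compresses_to_unshuffle (D1 h l + D2 h l) (D1 h l - D2 h l)
  (D4 h k l) (- D3 h k l) (- D3 h k l) (D4 h k l)
  0 (- D5 h p k l) (- D5 h p k l) 0 0 0 0 0 (D6 h n p).
have C1 := compresses_to_trans C
  (compresses_to_dsum (compresses_to_refl _)
    (compresses_to_dsum (compresses_to_refl _)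
      (compresses_to_dsum (compresses_to_symmetric _ _)
        (compresses_to_even_core _ _ _ _ _)))).
have [S1 S2] := has_spectrum_D1D2 l; have S3 := has_spectrum_D3D4 hf.
have S4 := has_spectrum_hyperbolic
  (\row_(i < p - 2 * l - 2 * k) h (2 * l + 2 * k + 1 + i)).
have S5 := has_spectrum_elliptic (\row_(i < n - p) h (p + 1 + i)).
have S := has_spectrum_dsum S1 (has_spectrum_dsum S2
  (has_spectrum_dsum S3 (has_spectrum_dsum S4 S5))).
have e1 : (l + (l + (0 + (0 + (n - p)))) = 2 * l + n - p)%N by lia.
have e2 : (0 + (0 + (0 + (p - 2 * l - 2 * k + 0))) = p - 2 * l - 2 * k)%N by lia.
have e3 : (0 + (0 + (k + (0 + 0))) = k)%N by lia.
rewrite e1 e2 e3 in S.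
by eexists; eexists; split; [| exact: C1 | exact: S]; lia.
Qed.

Lemma mxB_core n :
  (2 <= n)%N -> ~~ odd n -> (forall i, (1 <= i <= n)%N -> h i != 0) ->
  has_core (mxB h n) (2 * n) 0 0 (n %/ 2).
Proof.
move=> n2 en hf; pose m := ((n - 2) %/ 2)%N.
have C := compresses_to_unshuffle4 (Rmx (hdiag h (n %/ 2) m))
  (- dbl (hdiag h 1 m)) (- dbl (hdiag h 1 m)) (Rmx (hdiag h (n %/ 2) m))
  (D7 h n) (D5' h n) (D5' h n) (- D7 h n).
pose x : 'rV[R]_1 := \row_(i < 1) h (n - 1)%N.
(* D5' is h_(n-1) S, and S anticommutes with the rotation block D7 *)
pose S : 'M[R]_(1 + 1) := block_mx 1%:M 0 0 (- 1%:M).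
have SS : S *m S = 1%:M.
  rewrite mulmx_block !(mulmx0, mul0mx, addr0, add0r, mulmxN, mulNmx, opprK).
  by rewrite !mulmx1 -scalar_mx_block.
have KS : D5' h n *m S = dbl (diag_mx x).
  rewrite /D5' mulmx_block !(mulmx0, mul0mx, addr0, add0r, mulmxN, mulNmx).
  rewrite !(opprK, oppr0) !mulmx1 /dbl (_ : diag_mx x = (h (n - 1))%:M)//.
  by apply/matrixP => i j; rewrite !mxE ord1.
have SK : S *m D5' h n = D5' h n *m S.
  rewrite /D5' !mulmx_block !(mulmx0, mul0mx, addr0, add0r, mulmxN, mulNmx).
  by rewrite !mulmx1 !mul1mx.
have SJ : S *m D7 h n = - (D7 h n *m S).
  rewrite /D7 /Rmx !mulmx_block.
  rewrite !(mulmx0, mul0mx, addr0, add0r, mulmxN, mulNmx) !mulmx1 !mul1mx.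
  by rewrite opp_block_mx !oppr0 opprK.
have C1 := compresses_to_trans C (compresses_to_dsum (compresses_to_symmetric _ _)
  (compresses_to_cross SS SJ SK)).
rewrite KS in C1.
have S1 : has_spectrum (dsum_mx
    (Rmx (hdiag h (n %/ 2) m) - dbl (hdiag h 1 m))
    (Rmx (hdiag h (n %/ 2) m) + dbl (hdiag h 1 m))) 0 0 m.
  apply: has_spectrum_focus => j; rewrite mxE; apply: hf;
    by have := ltn_ord j; rewrite {2}/m; lia.
have S2 : has_spectrum
    (dsum_mx (D7 h n - dbl (diag_mx x)) (D7 h n + dbl (diag_mx x))) 0 0 1.
  apply: has_spectrum_focus => j; rewrite mxE; apply: hf;
    by have := ltn_ord j; lia.
have T := has_spectrum_dsum S1 S2.
have e3 : (m + 1 = n %/ 2)%N by rewrite /m; lia.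
rewrite e3 in T.
by eexists; eexists; split; [| exact: C1 | exact: T]; rewrite /m; lia.
Qed.

Lemma mxC_core n p k l :
  focus_parameters_neq0 h k l -> (2 * (k + l) + 1 <= p <= n)%N ->
  has_core (mxC h n p k l) (2 * n) (2 * l + 1 + n - p) (p - 2 * l - 2 * k - 1) k.
Proof.
move=> hf hp.
have [S1 S2] := has_spectrum_D1D2 l; have S3 := has_spectrum_D3D4 hf.
have S5 := has_spectrum_elliptic (\row_(i < n - p) h (p + 1 + i)).
(* the first diagonal entry of D5'' is 0, so that block is split as 1 + m *)
have Em : (p - 2 * l - 2 * k = (p - 2 * l - 2 * k - 1).+1)%N by lia.
rewrite /has_core /mxC /sizeC /D5'' /D8.
move: (p - 2 * l - 2 * k - 1)%N (erefl (p - 2 * l - 2 * k - 1)%N) Em => m Em' Em.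
rewrite Em.
pose d : 'rV[R]_m := \row_i h (2 * l + 2 * k + 1 + i.+1).
pose x : R := (Num.sqrt 2)^-1 * h (2 * l + 2 * k + 1).
rewrite [diag_mx _](_ : _ = block_mx (0 : 'M[R]_1) 0 0 (diag_mx d)); last first.
  transitivity (diag_mx (row_mx (0 : 'rV_1) d)); last by rewrite diag_mx_row linear0.
  congr diag_mx; apply/rowP => i; rewrite !mxE.
  by case: (split_ordP i) => r ->; rewrite !mxE ?ord1.
rewrite [_ *: _](_ : _ = (col_mx x%:M 0 : 'cV_(1 + m))); last first.
  apply/colP => i; rewrite !mxE.
  by case: (split_ordP i) => r ->; rewrite !mxE ?ord1 ?mulr1n ?mulr0.
set D5x := block_mx _ _ _ _; set Ex : 'cV_(1 + m) := col_mx _ _.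
have C := compresses_to_unshuffle_odd (D1 h l + D2 h l) (D1 h l - D2 h l)
  (D4 h k l) (D3 h k l) D5x Ex (D6 h n p).
have C1 := compresses_to_trans C
  (compresses_to_dsum (compresses_to_refl _)
    (compresses_to_dsum (compresses_to_refl _)
      (compresses_to_dsum (compresses_to_symmetric _ _)
        (compresses_to_odd_core _ _ _)))).
have S4 := has_spectrum_hyperbolic d.
have S6 : has_spectrum (block_mx 0 x%:M (- x%:M : 'M[R]_1) 0) 1 0 0.
  have := has_spectrum_elliptic (- x%:M : 'rV[R]_1).
  rewrite /Rmx (_ : diag_mx _ = - x%:M) ?opprK//.
  by apply/matrixP => i j; rewrite !mxE !ord1 eqxx !mulr1n.
have S := has_spectrum_dsum S1 (has_spectrum_dsum S2 (has_spectrum_dsum S3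
  (has_spectrum_dsum S6 (has_spectrum_dsum S4 S5)))).
have e1 : (l + (l + (0 + (1 + (0 + (n - p))))) = 2 * l + 1 + n - p)%N by lia.
have e2 : (0 + (0 + (0 + (0 + (m + 0)))) = m)%N by lia.
have e3 : (0 + (0 + (k + (0 + (0 + 0)))) = k)%N by lia.
rewrite e1 e2 e3 in S.
by eexists; eexists; split; [| exact: C1 | exact: S]; lia.
Qed.

End Cores.

(** * Restricting an endomorphism to its image *)

Section Matrices.
Variable F : fieldType.

(** Acting on row vectors, and for tuples of arbitrary length: the given basis
    of v has length p + q, which is only provably the dimension. *)
Definition hom_mx (U V : vectType F) m n (e : m.-tuple U) (e' : n.-tuple V)
    (f : 'Hom(U, V)) : 'M[F]_(m, n) :=
  \matrix_(i, j) coord e' j (f (tnth e i)).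

Lemma hom_mx_comp (U V W : vectType F) m n r (e : m.-tuple U)
    (e' : n.-tuple V) (e'' : r.-tuple W) (f : 'Hom(U, V)) (f' : 'Hom(V, W)) :
  basis_of fullv e' ->
  hom_mx e e'' (f' \o f)%VF = hom_mx e e' f *m hom_mx e' e'' f'.
Proof.
move=> be; apply/matrixP => i j; rewrite !mxE lfunE/=.
rewrite [f (tnth e i)](coord_basis be) ?memvf// !linear_sum/=.
by apply: eq_bigr => k _; rewrite !mxE !linearZ/= -tnth_nth.
Qed.

Lemma hom_mx_id (U : vectType F) m (e : m.-tuple U) (f : 'End(U)) :
  basis_of fullv e -> f =1 id -> hom_mx e e f = 1%:M.
Proof.
move=> be fid; apply/matrixP => i j; rewrite !mxE fid (tnth_nth 0).
by rewrite coord_free ?(basis_free be)// eq_sym.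
Qed.

Lemma mxofE (U V : vectType F) (e : (\dim {:U}).-tuple U)
    (e' : (\dim {:V}).-tuple V) f :
  passmx.mxof e e' f = hom_mx e e' f.
Proof.
by apply/matrixP => i j; rewrite !mxE /= passmx.vecof_delta (tnth_nth 0).
Qed.

End Matrices.

Section Restriction.
Variable R : realType.

Lemma end_mxE (V : vectType R) m (e : m.-tuple V) f : end_mx e f = (hom_mx e e f)^T.
Proof. by apply/matrixP => i j; rewrite !mxE. Qed.

(** For a factorization of an endomorphism of [V] through a surjection [pi] and
    an injection [iota], with sections [sg] and [sg'], the product in the other
    order is the restriction to the image. Its dimension is the rank, so the
    powers of X in [char_poly_mulC] and [char_poly_compresses_to] cancel. *)
Lemma char_poly_factorization (V T : vectType R) (pi sg' : 'Hom(V, T))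
    (iota sg : 'Hom(T, V)) N (e : N.-tuple V) n (W : 'M[R]_n) :
  basis_of fullv e -> cancel sg pi -> cancel iota sg' ->
  compresses_to (end_mx e (iota \o pi)%VF) W -> \rank (end_mx e (iota \o pi)%VF) = n ->
  char_poly (passmx.mxof (vbasis {:T}) (vbasis {:T}) (pi \o iota)%VF) = char_poly W.
Proof.
move=> be sgK iotaK C rk; pose b := vbasis {:T}.
have bb : basis_of fullv b := vbasisP _.
pose A := hom_mx e b pi; pose B := hom_mx b e iota.
have AB : hom_mx e e (iota \o pi)%VF = A *m B by rewrite (hom_mx_comp _ _ _ _ bb).
have SA : hom_mx b e sg *m A = 1%:M.
  by rewrite -hom_mx_comp// hom_mx_id// => t; rewrite lfunE/= sgK.
have BS : B *m hom_mx e b sg' = 1%:M.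
  by rewrite -hom_mx_comp// hom_mx_id// => t; rewrite lfunE/= iotaK.
rewrite mxofE (hom_mx_comp _ _ _ _ be) -/A -/B.
move: C rk; rewrite end_mxE mxrank_tr AB => C rk.
have dn : (\dim {:T} = n)%N.
  apply/eqP; rewrite -rk eqn_leq (leq_trans (mxrankM_maxl _ _)) ?rank_leq_col// andbT.
  rewrite -[X in (X <= _)%N](mxrank1 R) -(mulmx1 1%:M) -{1}SA -BS mulmxA -(mulmxA _ A).
  exact: leq_trans (mxrankM_maxl _ _) (mxrankM_maxr _ _).
have := char_poly_mulC A B; rewrite -(char_poly_tr (A *m B)).
rewrite [X in 'X^X]dn (char_poly_compresses_to C).
by move/mulfI => ->//; rewrite expf_neq0 ?polyX_eq0.
Qed.

End Restriction.

(** * The differential of a quadratic vector field *)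

Section Quadratic.
Import passmx.
Variables (R : realType).

Lemma is_diff_sum (V W : normedModType R) (I : finType) (f df : I -> V -> W) (x : V) :
  (forall i, is_diff x (f i) (df i)) -> is_diff x (\sum_i f i) (\sum_i df i).
Proof.
move=> h; elim/big_ind2: _ => [|g1 dg1 g2 dg2 h1 h2|i _].
- exact: is_diff_cst.
- exact: is_diffD.
- exact: h.
Qed.

Lemma is_diff_coord n (x : 'rV[R]_n) (a : 'I_n) :
  is_diff x (fun u : 'rV[R]_n => u 0 a) (fun u => u 0 a).
Proof.
apply: DiffDef; first exact: differentiable_coord.
pose f (u : 'rV[R]_n) : R := u 0 a.
have flin : linear f by move=> k u v; rewrite /f !mxE.
pose fM := GRing.isLinear.Build _ _ _ _ _ flin.
pose fL : {linear _ -> _} := HB.pack f fM.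
by rewrite -/f (_ : f = fL)// diff_lin//; exact: coord_continuous.
Qed.

Lemma is_diff_monomial n (W : normedModType R) (x : 'rV[R]_n) (a b : 'I_n) (w : W) :
  is_diff x (fun u : 'rV[R]_n => (u 0 a * u 0 b) *: w)
            (fun u => (x 0 a * u 0 b + x 0 b * u 0 a) *: w).
Proof.
have h : is_diff x (fun u : 'rV[R]_n => u 0 a * u 0 b)
    (fun u => x 0 a * u 0 b + x 0 b * u 0 a).
  exact: is_diffM (is_diff_coord x a) (is_diff_coord x b).
have [hd hv] := h.
apply: DiffDef; first exact: differentiableZl.
rewrite (diffZl w hd) /=; apply/funext => u /=.
by rewrite hv.
Qed.

Lemma linear_fun0 (U W : lmodType R) (f : U -> W) : linear f -> f 0 = 0.
Proof.
by move=> /(_ (-1) 0 0); rewrite !scaleN1r oppr0 addr0 addNr.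
Qed.

(** In coordinates the map is a sum of monomials of degree two, to which the
    product rule applies. *)
Lemma is_diff_quadratic (g : vectType R) (B : g -> g -> g) u :
  (forall Y, linear (B Y)) -> (forall Y, linear (B ^~ Y)) ->
  is_diff u (@gcoord R g \o (fun Y => B Y Y) \o @gvec R g)
    (fun w => gcoord (B (gvec u) (gvec w) + B (gvec w) (gvec u))).
Proof.
move=> lr ll; pose e := vbasis {:g}.
have lr0 Y : B Y 0 = 0 := linear_fun0 (lr Y).
have ll0 Y : B 0 Y = 0 := linear_fun0 (ll Y).
have expand (x y : 'rV_(\dim {:g})) :
    gcoord (B (gvec x) (gvec y)) =
      \sum_a \sum_b (x 0 a * y 0 b) *: gcoord (B e`_a e`_b).
  have -> : B (gvec x) (gvec y) = \sum_a x 0 a *: B e`_a (gvec y).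
    rewrite {1}/gvec /passmx.vecof; elim/big_ind2: _ => // [X1 Y1 X2 Y2 <- <-|k _].
      by have /= := ll (gvec y) 1 Y1 Y2; rewrite !scale1r.
    by have := ll (gvec y) (x 0 k) e`_k 0; rewrite !addr0 ll0 addr0.
  rewrite /gcoord linear_sum; apply: eq_bigr => a _; rewrite linearZ/=.
  have -> : B e`_a (gvec y) = \sum_b y 0 b *: B e`_a e`_b.
    rewrite {1}/gvec /passmx.vecof; elim/big_ind2: _ => // [X1 Y1 X2 Y2 <- <-|k _].
      by have := lr e`_a 1 Y1 Y2; rewrite !scale1r.
    by have := lr e`_a (y 0 k) e`_k 0; rewrite !addr0 lr0 addr0.
  by rewrite linear_sum scaler_sumr; apply: eq_bigr => b _; rewrite linearZ/= scalerA.
have h := is_diff_sum (fun a => is_diff_sum (fun b =>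
  is_diff_monomial u a b (gcoord (B e`_a e`_b)))).
have -> : @gcoord R g \o (fun Y => B Y Y) \o @gvec R g =
    \sum_a \sum_b (fun v : 'rV[R]_(\dim {:g}) =>
      (v 0 a * v 0 b) *: gcoord (B e`_a e`_b)).
  apply/funext => v; rewrite /= expand fct_sumE; apply: eq_bigr => a _.
  by rewrite fct_sumE.
apply: is_diff_eq h _; apply/funext => w.
rewrite [in RHS]/gcoord [in RHS]linearD/= -/(gcoord _) -/(gcoord _) !expand.
rewrite -big_split/= fct_sumE; apply: eq_bigr => a _.
rewrite fct_sumE -big_split/=; apply: eq_bigr => b _.
by rewrite scalerDl [w 0 a * _]mulrC.
Qed.

End Quadratic.

(** * The equilibrium on its coadjoint orbit *)

Section Equilibrium.
Import passmx.
Variables (R : realType) (g : vectType R).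
Variables (br : {bilinear g -> g -> g}) (form : {bilinear g -> g -> R | *%R & *%R}).
Variables (z v : {vspace g}).
Hypotheses (hform : scalar_product form) (hz : nondegenerate_on form z)
  (hv : orthogonal_complement form z v).

Lemma form_vz V Z : V \in v -> Z \in z -> form V Z = 0.
Proof. by move=> /hv; apply. Qed.

Lemma capv_center : (z :&: v = 0)%VS.
Proof.
apply/eqP; rewrite -subv0; apply/subvP => X; rewrite memv_cap => /andP[Xz Xv].
by rewrite memv0; apply/eqP/hz => // Y Yz; exact: form_vz.
Qed.

(** By a count of dimensions: [v] is the kernel of the map sending X to the
    values of its product with a basis of [z], so it has codimension at most
    the dimension of [z]. *)
Lemma addv_center : (z + v = fullv)%VS.
Proof.
pose phi X : 'rV[R]_(\dim z) := \row_i form X (vbasis z)`_i.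
have phi_lin : linear phi.
  by move=> k X Y; apply/rowP => i; rewrite !mxE linearPl.
pose phiM := GRing.isLinear.Build _ _ _ _ _ phi_lin.
pose f : 'Hom(g, 'rV[R]_(\dim z)) := linfun (HB.pack phi phiM : {linear _ -> _}).
have kerE : lker f = v.
  apply/vspaceP => X; rewrite memv_ker lfunE/=; apply/eqP/idP => [h|/hv h].
    apply/hv => Z Zz; rewrite (coord_vbasis Zz) linear_sumr big1// => i _.
    by move/rowP/(_ i): h; rewrite !mxE linearZr/= => ->; rewrite mulr0.
  by apply/rowP => i; rewrite !mxE h// vbasis_mem// mem_nth// size_tuple.
apply/eqP; rewrite eqEdim subvf/= dimv_disjoint_sum ?capv_center//.
have := limg_ker_dim f fullv; rewrite capfv kerE => <-.
by rewrite addnC leq_add2r (leq_trans (dimvS (subvf _)))// dimvf /dim/= mul1n.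
Qed.

Let pz := daddv_pi z v.
Let pv := daddv_pi v z.

Lemma pzv_add X : pz X + pv X = X.
Proof. by rewrite daddv_pi_add ?capv_center// addv_center memvf. Qed.

Lemma pz_id X : X \in z -> pz X = X.
Proof. exact: daddv_pi_id capv_center. Qed.

Lemma pv_id X : X \in v -> pv X = X.
Proof. by apply: daddv_pi_id; rewrite capvC capv_center. Qed.

Lemma pz_v X : X \in v -> pz X = 0.
Proof.
by move=> /pv_id Xv; have := pzv_add X; rewrite Xv => /(canRL (addrK _)); rewrite subrr.
Qed.

Lemma pv_z X : X \in z -> pv X = 0.
Proof.
move=> /pz_id Xz; have := pzv_add X; rewrite Xz addrC.
by move=> /(canRL (addrK _)); rewrite subrr.
Qed.

Lemma form_inj X Y : (forall V, form X V = form Y V) -> X = Y.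
Proof.
move=> h; apply/subr0_eq; apply: hform.2 => [|V _]; first exact: memvf.
by rewrite linearBl h subrr.
Qed.

Lemma form_inj_v X Y : X \in v -> Y \in v ->
  (forall V : subvs_of v, form X (vsval V) = form Y (vsval V)) -> X = Y.
Proof.
move=> Xv Yv h; apply: form_inj => V.
rewrite -(pzv_add V) (linearDr _ X) (linearDr _ Y)/=.
rewrite (form_vz Xv (memv_pi z v V)) (form_vz Yv (memv_pi z v V)); congr (_ + _).
by have := h (vsproj v (pv V)); rewrite vsprojK ?memv_pi.
Qed.

Variable j : subvs_of z -> 'End(subvs_of v).
Hypothesis hj : j_mapping br form j.

(** The defining equation of [j] is linear in Z, and it determines [j]. *)
Lemma j_linear V : linear (fun Z => j Z V).
Proof.
move=> k Z Z'; apply: val_inj; apply: form_inj_v; rewrite ?subvsP// => V'.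
by rewrite hj !linearPl/= !hj.
Qed.

(* lie_poisson j is the quadratic map of B *)
Let B (X Y : g) : g := vsval (j (vsproj z (pz X)) (vsproj v (pv Y))).

Lemma B_linr X : linear (B X).
Proof. by move=> k Y Y'; rewrite /B !linearP. Qed.

Lemma B_linl X : linear (B ^~ X).
Proof. by move=> k Y Y'; rewrite /B !linearP j_linear linearP. Qed.

Variables (Yv : subvs_of v) (Yz : subvs_of z).
Let Y := vsval Yv + vsval Yz.

Lemma vsproj_pz : vsproj z (pz Y) = Yz.
Proof. by rewrite linearD/= pz_v ?pz_id ?subvsP// add0r vsvalK. Qed.

Lemma vsproj_pv : vsproj v (pv Y) = Yv.
Proof. by rewrite linearD/= pv_id ?pv_z ?subvsP// addr0 vsvalK. Qed.

Lemma lie_poissonE : lie_poisson j Y = vsval (j Yz Yv).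
Proof. by rewrite /lie_poisson -/pz -/pv vsproj_pz vsproj_pv. Qed.

Hypothesis hbr : lie_bracket br.
Hypothesis hstep : step_two_nilpotent br z.

Let T : {vspace g} := limg (linfun vsval \o j Yz)%VF.

Lemma mem_image_j W : reflect (exists V, W = vsval (j Yz V)) (W \in T).
Proof.
apply: (iffP memv_imgP) => [[V _ ->]|[V ->]].
  by exists V; rewrite comp_lfunE lfunE.
by exists V; [exact: memvf | rewrite comp_lfunE lfunE].
Qed.

Lemma br_pv U V : br U V = br (pv U) (pv V).
Proof.
have brz X Z : Z \in z -> br Z X = 0 by move=> /hstep.1.
have brz' X Z : Z \in z -> br X Z = 0.
  move=> Zz; have := hbr.1 (X + Z).
  by rewrite linearDl/= !linearDr/= !hbr.1 (brz _ _ Zz) !(addr0, add0r).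
rewrite -{1}(pzv_add U) -{1}(pzv_add V) linearDl/= (brz _ _ (memv_pi z v U)) add0r.
by rewrite linearDr/= (brz' _ _ (memv_pi z v V)) add0r.
Qed.

Lemma coadE U V : form Y (br U V) = form (vsval (j Yz (vsproj v (pv U)))) V.
Proof.
rewrite /Y linearDl/= (form_vz (subvsP Yv) (hstep.2 U V)) add0r br_pv.
rewrite -[in RHS](pzv_add V) linearDr/= (form_vz (subvsP _) (memv_pi z v V)) add0r.
by rewrite -[in RHS](vsprojK (memv_pi v z V)) hj !vsprojK ?memv_pi.
Qed.

Lemma orbit_tangent_image : orbit_tangent br form Y T.
Proof.
move=> W; split=> [/mem_image_j[V ->]|[U hU]].
  by exists (vsval V) => V'; rewrite coadE pv_id ?subvsP// vsvalK.
by apply/mem_image_j; exists (vsproj v (pv U)); apply: form_inj => V; rewrite hU coadE.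
Qed.

Lemma mem_image_j_v W : W \in T -> W \in v.
Proof. by move/mem_image_j => [V ->]; rewrite subvsP. Qed.

Let pi : 'Hom(subvs_of v, subvs_of T) := (linfun (vsproj T) \o (linfun vsval \o j Yz))%VF.
Let iota : 'Hom(subvs_of T, subvs_of v) := (linfun (vsproj v) \o linfun vsval)%VF.

(** For W in the orbit directions, W_z = 0 kills the term j(W_z) Y_v of the
    differential. *)
Lemma linearization_image : linearization (lie_poisson j) Y (pi \o iota)%VF.
Proof.
have hB := is_diff_quadratic (gcoord Y) B_linr B_linl.
split; first exact: (ex_diff (is_diff_def := hB)).
move=> W; have -> := diff_val (is_diff_def := hB).
rewrite /gvec /gcoord !(rVofK (vbasisP _)).
have Wv := mem_image_j_v (subvsP W).
rewrite /B vsproj_pz vsproj_pv (pz_v Wv) (pv_id Wv) linear0.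
rewrite (linear_fun0 (j_linear Yv)) linear0 addr0 !comp_lfunE !lfunE/=.
by rewrite vsprojK//; apply/mem_image_j; eexists.
Qed.

(** The elliptic and hyperbolic parameters are non-zero because 0 is not an
    eigenvalue of the invertible matrix [W]. *)
Lemma type_of_core p (e : p.-tuple (subvs_of v)) N (W : 'M[R]_N) ke kh kf :
  basis_of fullv e -> j Yz Yv = 0 ->
  compresses_to (end_mx e (j Yz)) W -> \rank (end_mx e (j Yz)) = N ->
  has_spectrum W ke kh kf ->
  williamson_type br form (lie_poisson j) Y ke kh kf.
Proof.
move=> be j0 C rk [a [b [c [hc hs]]]].
split; first by rewrite lie_poissonE j0 linear0.
pose s := flatten (map (@elliptic_pair R) a) ++ flatten (map (@hyperbolic_pair R) b)
                  ++ flatten (map (@focus_quadruple R) c).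
have W_unit := unitmx_compresses_to C rk.
exists T, (pi \o iota)%VF, s; split.
- exact: orbit_tangent_image.
- exact: linearization_image.
- have jE : (iota \o pi)%VF = j Yz.
    apply/lfunP => V; rewrite !comp_lfunE !lfunE/=.
    by rewrite vsprojK ?vsvalK//; apply/mem_image_j; exists V.
  rewrite /eigenvalues -hs; congr map_poly.
  apply: (@char_poly_factorization _ _ _ _ (linfun (vsproj T) \o linfun vsval)%VF _
     ((linfun vsval \o j Yz)^-1 \o linfun vsval)%VF _ e) => //; rewrite ?jE//.
    move=> t; rewrite !comp_lfunE -(comp_lfunE (linfun vsval) (j Yz)).
    by rewrite limg_lfunVK ?lfunE/= ?vsvalK// subvsP.
  move=> t; rewrite !comp_lfunE !lfunE/=.
  by rewrite vsprojK ?vsvalK//; exact: mem_image_j_v (subvsP t).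
have s0 : 0 \notin s.
  rewrite -root_prod_XsubC -hs rootE horner_coef0 coef_map char_poly_det fmorph_eq0.
  by rewrite mulf_neq0 ?signr_eq0// -unitfE -unitmxE.
exists a, b, c; split=> //; apply/allP => m hm; apply: contraNneq s0 => m0.
  rewrite mem_cat; apply/orP; left; apply/flattenP; exists (elliptic_pair m).
    exact: map_f.
  by rewrite m0 /elliptic_pair oppr0 !inE eqxx.
rewrite !mem_cat; apply/orP; right; apply/orP; left; apply/flattenP.
exists (hyperbolic_pair m); first exact: map_f.
by rewrite m0 /hyperbolic_pair oppr0 !inE eqxx.
Qed.

End Equilibrium.

(** * The theorem *)

Section Conjugation.
Variable R : realType.

Lemma compresses_to_castmx m n (E : m = n) (M : 'M[R]_m) :
  compresses_to (castmx (E, E) M) M.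
Proof. by case: n / E; rewrite castmx_id; apply: compresses_to_refl. Qed.

Lemma conjugate_so_compresses p q N (A : 'M[R]_(p + q)) (M : 'M[R]_N) :
  conjugate_so A M -> compresses_to A M.
Proof.
move=> [a [E [aS ->]]].
apply: compresses_to_trans (compresses_to_castmx E M).
have SS : signature_mx R p q *m signature_mx R p q = 1%:M.
  rewrite mulmx_block !(mulmx0, mul0mx, addr0, add0r, mulmxN, mulNmx, opprK).
  by rewrite !mulmx1 -scalar_mx_block.
(* a preserves the form, so it is invertible: S a^T S is a left inverse *)
have au : a \in unitmx.
  have : (signature_mx R p q *m a^T *m signature_mx R p q) *m a = 1%:M.
    by rewrite -!mulmxA [a^T *m _]mulmxA aS SS.
  by move/mulmx1_unit => [].
by exists a, (invmx a); rewrite mulVmx.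
Qed.

End Conjugation.

Theorem theorem3p4 (R : realType) (g : vectType R)
    (br : {bilinear g -> g -> g}) (form : {bilinear g -> g -> R | *%R & *%R})
    (z v : {vspace g})
    (hbr : lie_bracket br) (hstep : step_two_nilpotent br z)
    (hform : scalar_product form) (hz : nondegenerate_on form z)
    (hv : orthogonal_complement form z v)
    (G : groupType) (expG : g -> G) (Ad : G -> 'End(g))
    (hG : lie_group br expG Ad)
    (j : subvs_of z -> 'End(subvs_of v)) (hj : j_mapping br form j)
    (p q : nat) (hpq : (p <= q)%N)
    (e : (p + q).-tuple (subvs_of v)) (he : pseudo_orthonormal form e)
    (O : set g) (hO : coadjoint_orbit form Ad O)
    (Yv : subvs_of v) (Yz : subvs_of z) (hYO : O (vsval Yv + vsval Yz))
    (hYv : Yv \in lker (j Yz)) :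
  let Y := vsval Yv + vsval Yz in
  let has_type := williamson_type br form (lie_poisson j) Y in
  [/\ forall (n k l : nat) (h : nat -> R),
        (p + q = 2 * n)%N -> (2 * (k + l) <= p)%N ->
        focus_parameters_neq0 h k l ->
        conjugate_so (end_mx e (j Yz)) (mxA h n p k l) ->
        \rank (mxA h n p k l) = (2 * n)%N ->
        has_type (2 * l + n - p)%N (p - 2 * l - 2 * k)%N k,
      forall (n : nat) (h : nat -> R),
        p = n -> q = n -> ~~ odd n -> (2 <= n)%N ->
        (forall i, (1 <= i <= n)%N -> h i != 0) ->
        conjugate_so (end_mx e (j Yz)) (mxB h n) ->
        \rank (mxB h n) = (2 * n)%N ->
        has_type 0%N 0%N (n %/ 2)%N
    & forall (n k l : nat) (h : nat -> R),
        (p + q = 2 * n + 1)%N -> (2 * (k + l) + 1 <= p)%N ->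
        focus_parameters_neq0 h k l ->
        conjugate_so (end_mx e (j Yz)) (mxC h n p k l) ->
        \rank (mxC h n p k l) = (2 * n)%N ->
        has_type (2 * l + 1 + n - p)%N (p - 2 * l - 2 * k - 1)%N k].
Proof.
have be : basis_of fullv e by case: he.
have j0 : j Yz Yv = 0 by apply/eqP; rewrite -memv_ker.
have main n M (A : 'M[R]_M) ke kh kf : conjugate_so (end_mx e (j Yz)) A ->
    \rank A = (2 * n)%N -> has_core A (2 * n) ke kh kf ->
    williamson_type br form (lie_poisson j) (vsval Yv + vsval Yz) ke kh kf.
  move=> /conjugate_so_compresses C rk [N [W [EN CW sW]]].
  apply: (type_of_core hform hz hv hj hbr hstep be j0 (compresses_to_trans C CW) _ sW).
  by rewrite (rank_compresses_to C) rk.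
split=> [n k l h hn hkl hf hc rk | n h hp hq hn n2 h0 hc rk | n k l h hn hkl hf hc rk].
- by apply: main hc rk _; apply: mxA_core => //; lia.
- by apply: main hc rk _; exact: mxB_core.
- by apply: main hc rk _; apply: mxC_core => //; lia.
Qed.
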